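(* Let $n\geq 2$ and let $C_{2n}$ be the cycle on $2n$ vertices. Put $a=4(2n-3)$. Then the Lanzhou eigenvalues of $C_{2n}$, listed with multiplicity, are $2a$, $-2a$, and $2a\cos\frac{\pi m}{n}$ for $m\in\{1,\ldots,2n-1\}$ with $m\neq n$.
   Context: Graphs are finite, simple and undirected. For a graph $G$ on $N$ vertices, $d_G(u)$ is the degree of $u$ in $G$ and $d_{\overline{G}}(u)=N-1-d_G(u)$ is its degree in the complement $\overline{G}$. The Lanzhou matrix $A_{Lz}(G)$ is the real symmetric $N\times N$ matrix indexed by vertices whose $(u,v)$ entry is $d_G(u)d_{\overline{G}}(u)+d_G(v)d_{\overline{G}}(v)$ if $u$ and $v$ are adjacent in $G$, and $0$ otherwise. The Lanzhou eigenvalues of $G$ are the eigenvalues of $A_{Lz}(G)$. *)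

(* Defs.v *)
From HB Require Import structures.
From mathcomp Require Import all_boot all_order all_algebra.
From mathcomp Require Import reals trigo.

Set Implicit Arguments.
Unset Strict Implicit.
Unset Printing Implicit Defensive.

Import GRing.Theory.

Local Open Scope ring_scope.

Record sgraph (N : nat) := SGraph {
  adj : rel 'I_N;
  adj_sym : symmetric adj;
  adj_irrefl : irreflexive adj }.

Definition deg (N : nat) (G : sgraph N) (u : 'I_N) : nat :=
  #|[set v | adj G u v]|.

Section Complement.
Variables (N : nat) (G : sgraph N).

Definition compl_adj : rel 'I_N := fun u v => (u != v) && ~~ adj G u v.

Lemma compl_adj_sym : symmetric compl_adj.
Proof. by move=> u v; rewrite /compl_adj eq_sym adj_sym. Qed.

Lemma compl_adj_irrefl : irreflexive compl_adj.
Proof. by move=> u; rewrite /compl_adj eqxx. Qed.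

Definition compl_graph : sgraph N := SGraph compl_adj_sym compl_adj_irrefl.

Lemma deg_compl (u : 'I_N) : deg compl_graph u = (N - 1 - deg G u)%N.
Proof.
rewrite /deg.
have -> : [set v | adj compl_graph u v] = ~: (u |: [set v | adj G u v]).
  by apply/setP => v; rewrite !inE /= /compl_adj negb_or eq_sym.
by rewrite cardsCs setCK cardsU1 inE adj_irrefl card_ord subnDA.
Qed.

End Complement.

Definition lanzhou_mx (R : nzRingType) (N : nat) (G : sgraph N) : 'M[R]_N :=
  \matrix_(u, v)
    if adj G u v then
      (deg G u * deg (compl_graph G) u + deg G v * deg (compl_graph G) v)%:R
    else 0.

(* [s] lists the eigenvalues of [A] with multiplicity, as the roots of the
   characteristic polynomial, in any order; in particular [size s = N]. *)
Definition eigenvalue_list (R : comNzRingType) (N : nat) (A : 'M[R]_N)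
    (s : seq R) : Prop :=
  char_poly A = \prod_(x <- s) ('X - x%:P).

Section Cycle.
Variable N : nat.

(* [ordS] is the successor modulo [N]. The conjunct [i != j] only matters
   for [N = 1], where it excludes a loop. *)
Definition cycle_adj : rel 'I_N :=
  fun i j => (i != j) && ((ordS i == j) || (ordS j == i)).

Lemma cycle_adj_sym : symmetric cycle_adj.
Proof. by move=> i j; rewrite /cycle_adj eq_sym orbC. Qed.

Lemma cycle_adj_irrefl : irreflexive cycle_adj.
Proof. by move=> i; rewrite /cycle_adj eqxx. Qed.

(* This is the cycle on [N] vertices only when [3 <= N]. *)
Definition cycle_graph : sgraph N := SGraph cycle_adj_sym cycle_adj_irrefl.

End Cycle.

(* Main.v *)
Require Import Defs.
From HB Require Import structures.
From mathcomp Require Import all_boot all_order all_algebra.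
From mathcomp Require Import reals trigo.
From mathcomp Require Import ring lra zify.

(** The Lanzhou matrix of the cycle on [N >= 3] vertices is [4 (N - 3)] times
    the adjacency matrix. With [cas x = cos x + sin x], the identity
    [cas (x + y) + cas (x - y) = 2 cos y cas x] shows that the vectors
    [cas (2 pi i k / N)], indexed by [i], are eigenvectors for
    [2 cos (2 pi k / N)]. They are the columns of the Hartley matrix, a real
    variant of the discrete Fourier matrix whose square is [N] times the
    identity, so they form a basis. *)

Set Implicit Arguments.
Unset Strict Implicit.
Unset Printing Implicit Defensive.

Import GRing.Theory.
Import Order.TTheory Num.Theory.

Local Open Scope ring_scope.

(** Over polynomials [('X - A) H = H ('X - D)]; taking determinants and cancelling [\det H] gives
    the equality without inverting [H]. *)
Lemma char_poly_intertwine (F : fieldType) (N : nat) (A D H : 'M[F]_N) :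
  \det H != 0 -> A *m H = H *m D -> char_poly A = char_poly D.
Proof.
move=> H0 AH; have HP0 : \det (map_mx polyC H) != 0 by rewrite det_map_mx polyC_eq0.
apply: (mulIf HP0); rewrite [RHS]mulrC /char_poly -!det_mulmx; congr (\det _).
by rewrite /char_poly_mx mulmxBl mulmxBr scalar_mxC -!map_mxM AH.
Qed.

(** * Trigonometric sums over equally spaced angles *)

Section Hartley.
Variable R : realType.
Implicit Types x y : R.

Lemma cos_eq1_sin x : cos x = 1 -> sin x = 0.
Proof.
by move=> c1; apply/eqP; rewrite -sqrf_eq0 sin2cos2 c1 expr1n subrr.
Qed.

Lemma cosM2pi (n : nat) : cos (2 * pi * n%:R) = 1 :> R.
Proof.
rewrite -[RHS](cos0 R) -(periodicn (@cosD2pi R) n 0).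
by congr cos; rewrite add0r -[RHS]mulr_natr -[pi *+ 2]mulr_natl.
Qed.

Lemma cos_lt1 x : 0 < x < 2 * pi -> cos x < 1.
Proof.
move=> /andP[x0 x2pi]; have s0 : 0 < sin (x / 2).
  by apply: sin_gt0_pi; apply/andP; split; lra.
have -> : cos x = 1 - 2 * sin (x / 2) ^+ 2.
  rewrite [in LHS](_ : x = (x / 2) *+ 2); last by field.
  by rewrite cos_mulr2n cos2sin2; ring.
nra.
Qed.

Lemma shift_sum (N : nat) (f : nat -> R) :
  f N = f 0%N -> \sum_(j < N) f j.+1 = \sum_(j < N) f j.
Proof.
move=> fN; apply: (addrI (f 0%N)).
by rewrite -(big_ord_recl N (fun j => f (nat_of_ord j))) big_ord_recr /= fN addrC.
Qed.

(* Rotating by [x] permutes the angles [j x], so the vector of the two sums is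
   fixed by a rotation, which is nontrivial unless [cos x = 1]. *)
Lemma sum_cos_sin (N : nat) x : cos (x * N%:R) = 1 ->
  \sum_(j < N) cos (x * j%:R) = (if cos x == 1 then N%:R else 0) /\
  \sum_(j < N) sin (x * j%:R) = 0.
Proof.
move=> cN; have sN := cos_eq1_sin cN.
case: eqP => [c1|/eqP c1].
  have s0 := cos_eq1_sin c1.
  have cs j : cos (x * j%:R) = 1.
    elim: j => [|j IH]; first by rewrite mulr0 cos0.
    by rewrite -natr1 mulrDr mulr1 cosD IH c1 s0 mulr0 subr0 mulr1.
  split.
    rewrite (eq_bigr (fun=> 1)) => [|j _]; last by rewrite cs.
    by rewrite sumr_const card_ord.
  by rewrite big1 // => j _; rewrite (cos_eq1_sin (cs j)).
have /= := @shift_sum N (fun j => cos (x * j%:R)).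
have /= := @shift_sum N (fun j => sin (x * j%:R)).
rewrite cN sN mulr0 sin0 cos0 => /(_ erefl) eS /(_ erefl) eC.
set C := \sum_(j < N) cos (x * j%:R) in eC *.
set S := \sum_(j < N) sin (x * j%:R) in eS *.
have {}eS : S * cos x + C * sin x = S.
  rewrite -[RHS]eS !mulr_suml -big_split /=; apply: eq_bigr => j _.
  by rewrite -natr1 mulrDr mulr1 sinD.
have {}eC : C * cos x - S * sin x = C.
  rewrite -[RHS]eC !mulr_suml -sumrB /=; apply: eq_bigr => j _.
  by rewrite -natr1 mulrDr mulr1 cosD.
(* This is the determinant [(1 - cos x)^2 + sin^2 x] of the identity minus the rotation; the
   combinations below are Cramer's rule for the system [eS], [eC]. *)
have d0 : 2 * (1 - cos x) != 0.
  by rewrite mulf_neq0 ?pnatr_eq0 // subr_eq0 eq_sym.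
have cs := cos2Dsin2 x.
split; apply: (mulfI d0); rewrite mulr0.
  transitivity ((1 - cos x) * (C - (C * cos x - S * sin x))
    + sin x * (S * cos x + C * sin x - S)
    + C * (1 - (cos x ^+ 2 + sin x ^+ 2))); first by ring.
  by rewrite eS eC cs !subrr !mulr0 !addr0.
transitivity ((1 - cos x) * (S - (S * cos x + C * sin x))
  - sin x * (C * cos x - S * sin x - C)
  + S * (1 - (cos x ^+ 2 + sin x ^+ 2))); first by ring.
by rewrite eS eC cs !subrr !mulr0 subr0 addr0.
Qed.

Definition cas x := cos x + sin x.

Lemma casDcasB x y : cas (x + y) + cas (x - y) = 2 * cos y * cas x.
Proof. by rewrite /cas !cosD !sinD cosN sinN; ring. Qed.

(** Splits the inner product of two columns into a cosine sum at the difference of the frequencies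
    and a sine sum at their sum. *)
Lemma casM x y : cas x * cas y = cos (x - y) + sin (x + y).
Proof. by rewrite /cas cosD sinD cosN sinN; ring. Qed.

Lemma casD2piM x (n : nat) : cas (x + 2 * pi * n%:R) = cas x.
Proof.
by rewrite /cas cosD sinD (cos_eq1_sin (cosM2pi n)) cosM2pi; ring.
Qed.

(** * The Hartley matrix *)

Section Matrix.
Variable N : nat.
Hypothesis N_gt0 : (0 < N)%N.

Let w : R := 2 * pi / N%:R.

Let N_neq0 : N%:R != 0 :> R.
Proof. by rewrite pnatr_eq0 -lt0n. Qed.

Let wN : w * N%:R = 2 * pi.
Proof. by rewrite /w divfK. Qed.

Definition hartley_mx : 'M[R]_N := \matrix_(i, k) cas (w * i%:R * k%:R).

Lemma cas_modn (m k : nat) : cas (w * (m %% N)%:R * k%:R) = cas (w * m%:R * k%:R).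
Proof.
rewrite [in RHS](divn_eq m N) -(casD2piM _ (m %/ N * k)) -wN.
by congr cas; rewrite natrD !natrM; ring.
Qed.

Lemma cos_w_eq1 (d : nat) : (d < N)%N -> (cos (w * d%:R) == 1) = (d == 0)%N.
Proof.
case: d => [|d] dN; first by rewrite mulr0 cos0 !eqxx.
have pi0 := pi_gt0 R.
rewrite lt_eqF // cos_lt1 // -wN /w; apply/andP; split.
  by rewrite mulr_gt0 ?divr_gt0 ?mulr_gt0 ?ltr0n.
by rewrite ltr_pM2l ?ltr_nat // divr_gt0 ?mulr_gt0 ?ltr0n.
Qed.

Lemma sum_cas (k l : nat) : (l <= k < N)%N ->
  \sum_(j < N) cas (w * k%:R * j%:R) * cas (w * l%:R * j%:R)
  = if k == l then N%:R else 0.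
Proof.
move=> /andP[lk kN].
have per (m : nat) : cos (w * m%:R * N%:R) = 1.
  by rewrite mulrAC wN cosM2pi.
(* The sine sum at [k + l] always vanishes, so the cosine sum at [k - l] alone decides between [N]
   and [0]. *)
have [+ _] := sum_cos_sin (per (k - l)%N).
have [_ +] := sum_cos_sin (per (k + l)%N).
rewrite cos_w_eq1 ?subn_eq0; last by lia.
rewrite (_ : (k <= l)%N = (k == l)); last by lia.
move=> S0 C0; rewrite -C0 -[RHS]addr0 -[X in _ = _ + X]S0 -big_split /=.
apply: eq_bigr => j _; rewrite casM -mulrBl -mulrDl -mulrBr -mulrDr.
by rewrite natrB ?natrD.
Qed.

Lemma hartley_mx_sqr : hartley_mx *m hartley_mx = N%:R%:M.
Proof.
apply/matrixP => k l; rewrite !mxE.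
(* The entry is symmetric in [k] and [l]; ordering them makes the natural number [k - l] in
   [sum_cas] a true difference. *)
wlog lk : k l / (l <= k)%N => [th|].
  case: (leqP l k) => [/th //|/ltnW /th]; rewrite eq_sym => <-.
  by apply: eq_bigr => j _; rewrite mulrC !mxE ![_ * j%:R * _]mulrAC.
transitivity (\sum_(j < N) cas (w * k%:R * j%:R) * cas (w * l%:R * j%:R)).
  by apply: eq_bigr => j _; rewrite !mxE [w * j%:R * _]mulrAC.
by rewrite sum_cas ?lk ?ltn_ord // -val_eqE; case: eqP.
Qed.

Lemma det_hartley_neq0 : \det hartley_mx != 0.
Proof.
apply: contra_neq (expf_neq0 N N_neq0) => H0.
by rewrite -det_scalar -hartley_mx_sqr det_mulmx H0 mul0r.
Qed.

(* The period is added to [i] to avoid the truncated predecessor of [0]. *)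
Lemma hartley_neighbours (i k : 'I_N) :
  hartley_mx (ordS i) k + hartley_mx (ord_pred i) k =
  2 * cos (w * k%:R) * hartley_mx i k.
Proof.
have -> : hartley_mx i k = cas (w * (i + N)%:R * k%:R).
  by rewrite -(cas_modn (i + N)) modnDr cas_modn mxE.
(* [ord_pred i] is [(i + N).-1] modulo [N], so [i.+1] is shifted by [N] too: both neighbours are
   then one step [w * k] away from [i + N]. *)
rewrite -casDcasB !mxE /= !cas_modn -(cas_modn i.+1) -(modnDr i.+1) cas_modn.
congr (cas _ + cas _); first by rewrite addSn -natr1; ring.
rewrite -[X in _ = w * X%:R * _ - _]prednK ?ltn_addl // -natr1; ring.
Qed.

End Matrix.

End Hartley.

(** * Neighbours, degrees and the Lanzhou matrix of the cycle *)

Section CycleGraph.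
Variable N : nat.
Hypothesis N_ge3 : (3 <= N)%N.

Lemma val_ordS (i : 'I_N) : ordS i = (if i.+1 == N then 0 else i.+1)%N :> nat.
Proof.
case: eqP => [/= ->|/eqP iN]; first by rewrite modnn.
by rewrite /= modn_small // ltn_neqAle iN ltn_ord.
Qed.

Lemma ordS_neq (i : 'I_N) : ordS i != i.
Proof.
by apply/eqP => /(congr1 (@nat_of_ord N)); rewrite val_ordS; case: eqP; lia.
Qed.

(** Applying [ordS] to both sides leaves a double successor against [i], and [2] is nonzero modulo
    [N] because [3 <= N]. This is what gives degree two. *)
Lemma ordS_neq_pred (i : 'I_N) : ordS i != ord_pred i.
Proof.
rewrite -(can2_eq (@ordSK N) (@ord_predK N)).
apply/eqP => /(congr1 (@nat_of_ord N)); rewrite !val_ordS.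
by do 2!case: eqP; lia.
Qed.

Lemma cycle_adjE (i j : 'I_N) :
  cycle_adj i j = (j \in [set ordS i; ord_pred i]).
Proof.
rewrite !inE /cycle_adj (can2_eq (@ordSK N) (@ord_predK N) j) [ordS i == j]eq_sym.
case: (eqVneq i j) => [<-|//] /=.
by rewrite -(can2_eq (@ordSK N) (@ord_predK N)) [i == _]eq_sym (negPf (ordS_neq i)).
Qed.

Lemma deg_cycle (i : 'I_N) : deg (cycle_graph N) i = 2.
Proof.
rewrite /deg /=.
rewrite (_ : [set v | _] = [set ordS i; ord_pred i]).
  by rewrite cards2 ordS_neq_pred.
by apply/setP => j; rewrite inE cycle_adjE.
Qed.

Lemma deg_compl_cycle (i : 'I_N) :
  deg (compl_graph (cycle_graph N)) i = (N - 3)%N.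
Proof. by rewrite deg_compl deg_cycle -subnDA. Qed.

(** Each endpoint of an edge contributes [2 * (N - 3)] to its entry, hence the factor
    [4 * (N - 3)]. *)
Lemma mul_lanzhou_cycle (R : nzRingType) (p : nat) (B : 'M[R]_(N, p)) i k :
  (lanzhou_mx R (cycle_graph N) *m B) i k =
  (4 * (N - 3))%:R * (B (ordS i) k + B (ord_pred i) k).
Proof.
rewrite mxE (eq_bigr (fun j => if j \in [set ordS i; ord_pred i]
    then (4 * (N - 3))%:R * B j k else 0)) => [|j _].
  by rewrite -big_mkcond big_setU1 ?inE ?ordS_neq_pred //= big_set1 mulrDr.
rewrite mxE /= cycle_adjE !deg_cycle !deg_compl_cycle.
by case: ifP; rewrite ?mul0r // addnn -mul2n mulnA.
Qed.

Lemma char_poly_lanzhou_cycle (R : realType) :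
  char_poly (lanzhou_mx R (cycle_graph N)) =
  \prod_(k < N) ('X - (2 * (4 * (N - 3))%:R * cos (2 * pi / N%:R * k%:R))%:P).
Proof.
have N_gt0 : (0 < N)%N by exact: leq_trans N_ge3.
pose d := \row_(k < N) (2 * (4 * (N - 3))%:R * cos (2 * pi / N%:R * k%:R) : R).
rewrite (char_poly_intertwine (D := diag_mx d) (det_hartley_neq0 R N_gt0)).
  rewrite char_poly_trig ?diag_mx_is_trig //.
  by apply: eq_bigr => k _; rewrite !mxE eqxx.
apply/matrixP => i k; rewrite mul_lanzhou_cycle hartley_neighbours //.
by rewrite mul_mx_diag !mxE; ring.
Qed.

End CycleGraph.

Theorem theorem30 (R : realType) (n : nat) (hn : (2 <= n)%N) :
  let a : R := 4 * (2 * n%:R - 3) in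
  eigenvalue_list (lanzhou_mx R (cycle_graph (2 * n)))
    [:: 2 * a, - (2 * a) &
      [seq 2 * a * cos (pi * m%:R / n%:R) | m <- index_iota 1 (2 * n) & m != n]].
Proof.
move=> a; have n0 : n%:R != 0 :> R by rewrite pnatr_eq0; lia.
rewrite /eigenvalue_list char_poly_lanzhou_cycle; last by lia.
(* Since [2 <= n], the natural subtraction [2 * n - 3] agrees with the real one in [a]. *)
have eigE k : 2 * (4 * (2 * n - 3))%:R * cos (2 * pi / (2 * n)%:R * k%:R)
    = 2 * a * cos (pi * k%:R / n%:R) :> R.
  congr (_ * cos _); last by rewrite natrM; field.
  by rewrite /a natrM natrB ?natrM //; lia.
under [LHS]eq_bigr do rewrite eigE.
pose f k : {poly R} := 'X - (2 * a * cos (pi * k%:R / n%:R))%:P.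
(* The frequency [0] is split off for [2 * a], then the frequency [n], where the cosine is
   [cos pi = -1], for [- (2 * a)]. *)
rewrite -[LHS](big_mkord xpredT f) big_ltn; last by lia.
rewrite (bigD1_seq n) ?iota_uniq //=; last by rewrite mem_index_iota; lia.
rewrite !big_cons big_map big_filter /f mulr0 mul0r cos0 mulr1 mulfK //.
by rewrite cospi mulrN1.
Qed.
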